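(* Let $A$ be a Banach algebra with a bounded approximate identity, and let $A^{**}$ be its second dual equipped with the first Arens multiplication. If $\mathrm{Soc}(A^{**}) = A^{**}$, then $A$ is finite dimensional.
   Context: The first Arens multiplication on $A^{**}$ is defined as follows: for $a, b \in A$, $f \in A^{*}$ and $F, G \in A^{**}$, the elements $fa, Ff \in A^{*}$ and $GF \in A^{**}$ are defined by $\langle fa, b\rangle = \langle f, ab\rangle$, $\langle Ff, a\rangle = \langle F, fa\rangle$, $\langle GF, f\rangle = \langle G, Ff\rangle$. With this multiplication $A^{**}$ is a Banach algebra. For a Banach algebra $B$, $\mathrm{Soc}(B)$ denotes the left socle of $B$: if $B$ has minimal left ideals, it is the smallest left ideal of $B$ containing all of them (i.e. their sum); if $B$ has no minimal left ideals, $\mathrm{Soc}(B) = (0)$. *)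

(* Defs.v *)
From HB Require Import structures.
From mathcomp Require Import all_boot all_order all_algebra.
From mathcomp Require Import all_classical all_reals all_analysis.
From mathcomp Require Export complex.

Set Implicit Arguments.
Unset Strict Implicit.
Unset Printing Implicit Defensive.

Import Order.TTheory GRing.Theory Num.Theory.
Import numFieldNormedType.Exports.

Local Open Scope classical_set_scope.
Local Open Scope complex_scope.
Local Open Scope ring_scope.

(* MathComp's ring structures are all unital, whereas Banach algebras need not
   have an identity; hence a multiplication on a bare normed module. *)
HB.mixin Record NormedModule_isNormedAlgebra (K : numFieldType) A
    & NormedModule K A := {
  amul : A -> A -> A;
  amulA : associative amul;
  amulDl : left_distributive amul +%R;
  amulDr : right_distributive amul +%R;
  amulZl : forall (k : K) (a b : A), amul (k *: a) b = k *: amul a b;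
  amulZr : forall (k : K) (a b : A), amul a (k *: b) = k *: amul a b;
  ler_norm_amul : forall a b : A, `|amul a b| <= `|a| * `|b|
}.

#[short(type="normedAlgType")]
HB.structure Definition NormedAlgebra (K : numFieldType) :=
  {A of NormedModule K A & NormedModule_isNormedAlgebra K A}.

#[short(type="banachAlgType")]
HB.structure Definition BanachAlgebra (K : numFieldType) :=
  {A of NormedAlgebra K A & CompleteNormedModule K A}.

Notation "a ** b" := (amul a b) (at level 40, left associativity) : ring_scope.

Section ideals.
Context (K : numFieldType) (B : normedAlgType K).

Definition left_ideal (I : set B) : Prop :=
  [/\ I 0, forall a b, I a -> I b -> I (a + b),
      forall (k : K) a, I a -> I (k *: a) & forall a b, I b -> I (a ** b)].

Definition minimal_left_ideal (L : set B) : Prop :=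
  [/\ left_ideal L, L <> [set 0] &
      forall J, left_ideal J -> J `<=` L -> J = [set 0] \/ J = L].

(* When there is no minimal left ideal this is the smallest left ideal,
   that is, [set 0]. *)
Definition socle : set B :=
  smallest left_ideal (\bigcup_(L in minimal_left_ideal) L).

End ideals.
Arguments socle {K} B.

Section nets.

(* le i j means that j is further along the net than i. *)
Definition directed (I : Type) (le : I -> I -> Prop) : Prop :=
  [/\ inhabited I, forall i, le i i,
      forall i j k, le i j -> le j k -> le i k &
      forall i j, exists k, le i k /\ le j k].

Definition net_filter (I : Type) (le : I -> I -> Prop) : set_system I :=
  [set P | exists i0, forall i, le i0 i -> P i].

Definition bounded_approximate_identity (K : numFieldType)
    (A : normedAlgType K) (I : Type) (le : I -> I -> Prop) (e : I -> A) :=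
  [/\ directed le, exists M : K, forall i, `|e i| <= M &
      forall a : A, (e i ** a @[i --> net_filter le] --> a) /\
                    (a ** e i @[i --> net_filter le] --> a)].

Definition has_bounded_approximate_identity (K : numFieldType)
    (A : normedAlgType K) : Prop :=
  exists (I : Type) (le : I -> I -> Prop) (e : I -> A),
    bounded_approximate_identity le e.

End nets.

Definition finite_dimensional (K : numFieldType) (V : lmodType K) : Prop :=
  exists (n : nat) (v : 'I_n -> V),
    forall x : V, exists c : 'I_n -> K, x = \sum_(i < n) c i *: v i.

Section dual.
Context (R : realType) (A : normedModType R[i]).

Definition dual_pred : {pred A -> R[i]^o} :=
  [pred f : A -> R[i]^o | `[< linear f /\ continuous f >]].

Record dual := Dual {
  dual_fun :> A -> R[i]^o;
  dual_subproof : dual_fun \in dual_pred }.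

HB.instance Definition _ := [isSub for dual_fun].
HB.instance Definition _ := [Choice of dual by <:].

Lemma dual_predP (f : A -> R[i]^o) :
  reflect (linear f /\ continuous f) (f \in dual_pred).
Proof. exact: asboolP. Qed.

Lemma dual_linear (f : dual) : linear f.
Proof. by have /dual_predP[] := dual_subproof f. Qed.

Lemma dual_continuous (f : dual) : continuous f.
Proof. by have /dual_predP[] := dual_subproof f. Qed.

HB.instance Definition _ (f : dual) :=
  GRing.isLinear.Build R[i] A R[i]^o *:%R f (@dual_linear f).

Lemma dual_pred_submod : submod_closed dual_pred.
Proof.
split.
  apply/dual_predP; split=> [a x y|x]; last exact: cst_continuous.
  by rewrite scaler0 addr0.
move=> k f g /dual_predP[lf cf] /dual_predP[lg cg].
apply/dual_predP; split=> [a x y|x].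
  rewrite !fctE lf lg !scalerDr !scalerA (mulrC k).
  by rewrite addrACA.
apply: (@continuousD _ _ _ (fun x => k *: f x) g); last exact: cg.
by apply: (@continuousZl_tmp _ _ _ f k); exact: cf.
Qed.

HB.instance Definition _ := GRing.isSubmodClosed.Build _ _ dual_pred
  dual_pred_submod.
HB.instance Definition _ := [SubChoice_isSubLmodule of dual by <:].

Lemma dualD (f g : dual) x : (f + g) x = f x + g x. Proof. by []. Qed.
Lemma dualZ k (f : dual) x : (k *: f) x = k *: f x. Proof. by []. Qed.
Lemma dual_ext (f g : dual) : (forall x, f x = g x) -> f = g.
Proof. by move=> fg; apply/val_inj/funext. Qed.

(* The library's norms take their values in the scalar field, so the supremum,
   computed in R, is cast to R[i]. *)
Definition dual_norm (f : dual) : R[i] :=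
  (sup [set complex.Re `|f x| | x in [set x : A | `|x| <= 1]])%:C.


Lemma dual_bounded (f : dual) :
  exists2 M : R, 0 <= M & forall x, `|f x| <= M%:C * `|x|.
Proof.
have /linear_bounded_continuous/linear_boundedP := @dual_continuous f.
move=> /pinfty_ex_gt0[M M0 fM]; exists (complex.Re M) => [|x].
  by rewrite -lecR RRe_real ?ltW// gtr0_real.
by rewrite RRe_real ?gtr0_real//; exact: fM.
Qed.

Lemma dual_norm_has_sup (f : dual) :
  has_sup [set complex.Re `|f x| | x in [set x : A | `|x| <= 1]].
Proof.
split; first by exists (complex.Re `|f 0|), 0 => //=; rewrite normr0 ler01.
have [M M0 fM] := dual_bounded f.
exists M; apply/ubP => _ [x x1 <-]; have {}x1 : `|x| <= 1 := x1.
rewrite -lecR RRe_real ?normr_real//.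
by rewrite (le_trans (fM x))// ler_piMr// lecR.
Qed.

Lemma dual_norm_ge0 (f : dual) : 0 <= dual_norm f.
Proof.
rewrite lecR (@le_trans _ _ (complex.Re `|f 0|))//.
  by rewrite -lecR RRe_real ?normr_real//; exact: normr_ge0.
apply: ub_le_sup; first by have [] := dual_norm_has_sup f.
by exists 0 => //=; rewrite normr0 ler01.
Qed.

Lemma ler_dual_norm (f : dual) x : `|f x| <= dual_norm f * `|x|.
Proof.
have [->|x0] := eqVneq x 0; first by rewrite linear0 !normr0 mulr0.
have nx0 : 0 < `|x| by rewrite normr_gt0.
have -> : f x = `|x| * f (`|x|^-1 *: x).
  by rewrite linearZ /= -[_ *: f x]/(_ * f x) mulrA mulfV ?mul1r// gt_eqF.
rewrite normrM normr_id mulrC ler_pM2r//.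
rewrite -[leLHS]RRe_real ?normr_real// lecR.
apply: ub_le_sup; first by have [] := dual_norm_has_sup f.
by exists (`|x|^-1 *: x) => //=; rewrite normrZ normfV normr_id mulVf ?gt_eqF.
Qed.

Lemma dual_norm_le (f : dual) (M : R[i]) : 0 <= M ->
  (forall x, `|f x| <= M * `|x|) -> dual_norm f <= M.
Proof.
move=> M0 fM; rewrite -[M]RRe_real ?ger0_real// lecR.
apply: ge_sup; first by have [] := dual_norm_has_sup f.
apply/ubP => _ [x x1 <-]; have {}x1 : `|x| <= 1 := x1.
rewrite -lecR !RRe_real ?normr_real ?ger0_real//.
by rewrite (le_trans (fM x))// ler_piMr.
Qed.

Lemma dual_norm_triangle (f g : dual) :
  dual_norm (f + g) <= dual_norm f + dual_norm g.
Proof.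
apply: dual_norm_le => [|x]; first by rewrite addr_ge0 ?dual_norm_ge0.
by rewrite dualD (le_trans (ler_normD _ _))// mulrDl lerD ?ler_dual_norm.
Qed.

Lemma dual_normZ k (f : dual) : dual_norm (k *: f) = `|k| * dual_norm f.
Proof.
have le_normZ l (g : dual) : dual_norm (l *: g) <= `|l| * dual_norm g.
  apply: dual_norm_le => [|x]; first by rewrite mulr_ge0 ?dual_norm_ge0.
  by rewrite dualZ normrM -mulrA ler_wpM2l// ler_dual_norm.
apply/le_anti; rewrite le_normZ /=.
have [->|k0] := eqVneq k 0; first by rewrite normr0 mul0r dual_norm_ge0.
rewrite -ler_pdivlMl ?normr_gt0// -normfV.
by rewrite -{1}[f]scale1r -(mulVf k0) -scalerA le_normZ.
Qed.

Lemma dual_norm_eq0 (f : dual) : dual_norm f = 0 -> f = 0.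
Proof.
move=> f0; apply: dual_ext => x; apply/eqP; rewrite -normr_le0.
by rewrite (le_trans (ler_dual_norm f x))// f0 mul0r.
Qed.

HB.instance Definition _ := Lmodule_isNormed.Build R[i] dual
  dual_norm_triangle dual_normZ dual_norm_eq0.

Lemma dual_normE (f : dual) : `|f| = dual_norm f. Proof. by []. Qed.

Lemma bounded_dual_pred (f : A -> R[i]^o) (M : R[i]) :
  linear f -> (forall x, `|f x| <= M * `|x|) -> f \in dual_pred.
Proof.
move=> lf fM; apply/dual_predP; split=> //.
pose g : {linear A -> R[i]^o} :=
  HB.pack f (GRing.isLinear.Build R[i] A R[i]^o *:%R f lf).
apply: (@bounded_linear_continuous _ _ _ g); apply/linear_boundedP.
have M_real (x : A) : x != 0 -> M \is Num.real.
  move=> x0; have nx0 : 0 < `|x| by rewrite normr_gt0.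
  apply: ger0_real; rewrite -(pmulr_lge0 _ nx0).
  exact: le_trans (normr_ge0 _) (fM x).
have [[x x0]|A0] := pselect (exists x : A, x != 0).
  near=> r => y; rewrite (le_trans (fM y))// ler_wpM2r//.
  by near: r; apply: nbhs_pinfty_ge; exact: M_real x0.
near=> r => y; have [->|y0] := eqVneq y 0; last by case: A0; exists y.
by rewrite linear0 !normr0 mulr0.
Unshelve. all: by end_near. Qed.

End dual.

Section arens.
Context (R : realType) (A : normedAlgType R[i]).
Implicit Types (a b : A) (f : dual A) (F G : dual (dual A)).

(* In the usual notation, dual_mulr f a is fa, bidual_act F f is Ff and
   arens G F is the first Arens product GF. *)

Lemma dual_mulr_subproof f a : (fun b => f (a ** b)) \in @dual_pred R A.
Proof.
apply: (@bounded_dual_pred _ _ _ (`|f| * `|a|)) => [k x y|x].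
  by rewrite amulDr amulZr linearP.
rewrite (le_trans (ler_dual_norm f _))// -mulrA ler_wpM2l ?dual_norm_ge0//.
exact: ler_norm_amul.
Qed.

Definition dual_mulr f a : dual A := Dual (dual_mulr_subproof f a).

Lemma dual_mulrP f : linear (dual_mulr f).
Proof.
by move=> k a b; apply: dual_ext => x; rewrite dualD dualZ /= amulDl amulZl linearP.
Qed.

Lemma dual_mulr_linear a : linear (dual_mulr^~ a).
Proof. by move=> k f g; apply: dual_ext. Qed.

Lemma norm_dual_mulr f a : `|dual_mulr f a| <= `|f| * `|a|.
Proof.
apply: dual_norm_le => [|b]; first by rewrite mulr_ge0.
rewrite (le_trans (ler_dual_norm f _))// -mulrA ler_wpM2l ?dual_norm_ge0//.
exact: ler_norm_amul.
Qed.

Lemma bidual_act_subproof F f : (fun a => F (dual_mulr f a)) \in @dual_pred R A.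
Proof.
apply: (@bounded_dual_pred _ _ _ (`|F| * `|f|)) => [k x y|x].
  by rewrite dual_mulrP linearP.
rewrite (le_trans (ler_dual_norm F _))// -mulrA ler_wpM2l ?dual_norm_ge0//.
exact: norm_dual_mulr.
Qed.

Definition bidual_act F f : dual A := Dual (bidual_act_subproof F f).

Lemma bidual_act_linear F : linear (bidual_act F).
Proof.
move=> k f g; apply: dual_ext => x.
by rewrite dualD dualZ /= dual_mulr_linear linearP.
Qed.

Lemma norm_bidual_act F f : `|bidual_act F f| <= `|F| * `|f|.
Proof.
apply: dual_norm_le => [|a]; first by rewrite mulr_ge0.
rewrite (le_trans (ler_dual_norm F _))// -mulrA ler_wpM2l ?dual_norm_ge0//.
exact: norm_dual_mulr.
Qed.

Lemma arens_subproof G F : (fun f => G (bidual_act F f)) \in @dual_pred R (dual A).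
Proof.
apply: (@bounded_dual_pred _ _ _ (`|G| * `|F|)) => [k x y|x].
  by rewrite bidual_act_linear linearP.
rewrite (le_trans (ler_dual_norm G _))// -mulrA ler_wpM2l ?dual_norm_ge0//.
exact: norm_bidual_act.
Qed.

Definition arens G F : dual (dual A) := Dual (arens_subproof G F).

Lemma arensA : associative arens.
Proof.
move=> H G F; apply: dual_ext => f /=; congr (H _); apply: dual_ext => a /=.
congr (G _); apply: dual_ext => b /=; congr (F _); apply: dual_ext => c /=.
by rewrite amulA.
Qed.

Lemma arensDl : left_distributive arens +%R.
Proof. by move=> H G F; apply: dual_ext. Qed.

Lemma arensDr : right_distributive arens +%R.
Proof.
move=> H G F; apply: dual_ext => f; rewrite dualD /= -linearD.
by congr (H _); apply: dual_ext.
Qed.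

Lemma arensZl k G F : arens (k *: G) F = k *: arens G F.
Proof. exact: dual_ext. Qed.

Lemma arensZr k G F : arens G (k *: F) = k *: arens G F.
Proof.
apply: dual_ext => f; rewrite dualZ /= -linearZ.
by congr (G _); apply: dual_ext.
Qed.

Lemma ler_norm_arens G F : `|arens G F| <= `|G| * `|F|.
Proof.
apply: dual_norm_le => [|f]; first by rewrite mulr_ge0.
rewrite (le_trans (ler_dual_norm G _))// -mulrA ler_wpM2l ?dual_norm_ge0//.
exact: norm_bidual_act.
Qed.

End arens.

Definition bidual (R : realType) (A : normedModType R[i]) := dual (dual A).

HB.instance Definition _ (R : realType) (A : normedModType R[i]) :=
  NormedModule.copy (bidual A) (dual (dual A)).

HB.instance Definition _ (R : realType) (A : normedAlgType R[i]) :=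
  NormedModule_isNormedAlgebra.Build R[i] (bidual A) (@arensA R A)
    (@arensDl R A) (@arensDr R A) (@arensZl R A) (@arensZr R A)
    (@ler_norm_arens R A).

(* Main.v *)
Require Import Defs.
From HB Require Import structures.
From mathcomp Require Import all_boot all_order all_algebra.
From mathcomp Require Import all_classical all_reals all_analysis.
From mathcomp Require Import complex.
From mathcomp Require Import lra.

Set Implicit Arguments.
Unset Strict Implicit.
Unset Printing Implicit Defensive.

Import Order.TTheory GRing.Theory Num.Theory.
Import numFieldNormedType.Exports.

Local Open Scope classical_set_scope.
Local Open Scope complex_scope.
Local Open Scope ring_scope.

(** Write B for the second dual with the first Arens product.  Two things are
    needed about it: it has a right identity E, and A embeds linearly in it.

    The functional E is a Banach limit of the bounded approximate identity:
    since (f a)(e_i) = f (a e_i) tends to f (a), any such limit satisfies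
    (E f)(a) = E (f a) = f (a), hence E f = f, and F E = F for all F in B
    ([bidual_right_identity]).  That the canonical map of A into B is
    injective is the Hahn-Banach theorem ([dual_separates]).  Both come from
    the existence of a linear functional below a given sublinear one, which
    holds because a minimal sublinear functional is linear
    ([linear_minorant]).

    The rest is algebra in B.  The socle is the sum of the minimal left
    ideals, so E is a sum of elements e_i of finitely many minimal left ideals
    L_i; when none of the L_i can be omitted, the e_i are nonzero idempotents
    ([idempotent_decomposition]).  By Schur's lemma e_i B e_i is a
    division algebra, and by the Gelfand-Mazur theorem it consists of the
    multiples of e_i ([minimal_corner_scalar]); again by Schur, each e_j B e_i
    has dimension at most one.  These pieces determine the elements of B.
    Indeed, if e_j x e_i = 0 for all j, then E x e_i = 0; the elements of L_i
    killed by E on the left form a left ideal which does not contain e_i, so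
    it is zero and x e_i = 0; and x = x E is the sum of the x e_i
    ([socle_rank1_maps]).  Thus finitely many maps of rank at most one
    separate the points of B, hence those of A, and A is finite dimensional.

    The Gelfand-Mazur theorem is obtained without complex integration.  If
    the resolvent r of an element is defined on all of R[i], its norm attains
    a maximum.  Averaging r over the n-th roots of c^n around a maximum point
    l gives r l up to an error exponentially small in n, so that no value
    r (l + c) with c small can have smaller norm; the norm of r is then
    constant along a ray, although it tends to zero at infinity
    ([no_entire_resolvent]). *)

(** * Real-valued norms *)

(** Norms on a space over R[i] take their values in R[i], which is only
    partially ordered; the estimates are made in R. *)
Definition rnorm (R : realType) (V : normedZmodType R[i]) (x : V) : R :=
  complex.Re `|x|.

Section real_norm.
Context (R : realType).

Lemma rnormE (V : normedZmodType R[i]) (x : V) : (rnorm x)%:C = `|x|.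
Proof. by rewrite RRe_real// normr_real. Qed.

Lemma rnorm_ge0 (V : normedZmodType R[i]) (x : V) : 0 <= rnorm x.
Proof. by rewrite -ler0c rnormE. Qed.

Lemma rnorm0 (V : normedZmodType R[i]) : rnorm (0 : V) = 0.
Proof. by rewrite /rnorm normr0. Qed.

Lemma rnorm_eq0 (V : normedZmodType R[i]) (x : V) : rnorm x = 0 -> x = 0.
Proof. by move=> x0; apply/normr0_eq0; rewrite -rnormE x0. Qed.

Lemma rnorm_gt0 (V : normedZmodType R[i]) (x : V) : x <> 0 -> 0 < rnorm x.
Proof.
move=> x0; rewrite lt_neqAle rnorm_ge0 andbT eq_sym.
by apply/eqP => /rnorm_eq0.
Qed.

Lemma ler_rnormD (V : normedZmodType R[i]) (x y : V) :
  rnorm (x + y) <= rnorm x + rnorm y.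
Proof. by rewrite -lecR rmorphD /= !rnormE ler_normD. Qed.

Lemma rnormN (V : normedZmodType R[i]) (x : V) : rnorm (- x) = rnorm x.
Proof. by rewrite /rnorm normrN. Qed.

Lemma rnormM (k l : R[i]) : rnorm (k * l) = rnorm k * rnorm l.
Proof. by apply/complexI; rewrite rmorphM /= !rnormE normrM. Qed.

Lemma rnormR (t : R) : rnorm t%:C = `|t|.
Proof. by apply/complexI; rewrite rnormE normc_def /= expr0n addr0 sqrtr_sqr. Qed.

Lemma rnorm_i : rnorm ('i : R[i]) = 1.
Proof.
by apply/complexI; rewrite rnormE normc_def /= expr0n expr1n add0r sqrtr1.
Qed.

Lemma rnormZ (V : normedModType R[i]) (k : R[i]) (x : V) :
  rnorm (k *: x) = rnorm k * rnorm x.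
Proof. by apply/complexI; rewrite rmorphM /= !rnormE normrZ. Qed.

Lemma rnorm_amul (B : normedAlgType R[i]) (a b : B) :
  rnorm (a ** b) <= rnorm a * rnorm b.
Proof. by rewrite -lecR rmorphM /= !rnormE ler_norm_amul. Qed.

Lemma normRe_le_rnorm (z : R[i]) : `|complex.Re z| <= rnorm z.
Proof. by rewrite -lecR rnormE normc_ge_Re. Qed.

Lemma Re_le_rnorm (z : R[i]) : complex.Re z <= rnorm z.
Proof. exact: le_trans (ler_norm _) (normRe_le_rnorm z). Qed.

Lemma normIm_le_rnorm (z : R[i]) : `|complex.Im z| <= rnorm z.
Proof.
have := normRe_le_rnorm (z * 'i).
by rewrite ReiNIm normrN rnormM rnorm_i mulr1.
Qed.

Lemma rnorm_le_ReIm (z : R[i]) :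
  rnorm z <= `|complex.Re z| + `|complex.Im z|.
Proof.
rewrite {1}[z]complexE; apply: le_trans (ler_rnormD _ _) _.
by rewrite rnormM !rnormR rnorm_i mul1r.
Qed.

End real_norm.

(** * Sublinear functionals and separation of points *)

Section sublinear.
Context (R : realType) (V : lmodType R[i]).
Implicit Types (p : V -> R) (x y : V).

Definition sublinear p :=
  (forall x y, p (x + y) <= p x + p y) /\
  (forall (t : R) x, 0 <= t -> p (t%:C *: x) = t * p x).

Lemma sublinear0 p : sublinear p -> p 0 = 0.
Proof. by case=> _ /(_ 0 0 (lexx _)); rewrite scaler0 mul0r. Qed.

Lemma sublinear_ge p x : sublinear p -> - p (- x) <= p x.
Proof.
move=> sp; have := sp.1 x (- x); rewrite subrr sublinear0//; lra.
Qed.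

(** Lower bounds of chains, tilts and upper limits along a net are all
    pointwise infima of this kind. *)
Lemma sublinear_inf (S : V -> set R) :
  (forall x, S x !=set0) -> (forall x, has_lbound (S x)) ->
  (forall x y a b, S x a -> S y b -> exists2 c, S (x + y) c & c <= a + b) ->
  (forall (t : R) x a, 0 < t -> S x a -> S (t%:C *: x) (t * a)) ->
  sublinear (fun x => inf (S x)).
Proof.
move=> S0 Sb SD SZ.
have leZ t x : 0 < t -> inf (S (t%:C *: x)) <= t * inf (S x).
  move=> t0; rewrite -ler_pdivrMl//; apply: lb_le_inf => // a Sa.
  by rewrite ler_pdivrMl//; apply: ge_inf => //; exact: SZ.
split=> [x y|t x].
  rewrite -lerBlDr; apply: lb_le_inf => // a Sa.
  rewrite lerBlDl -lerBlDr; apply: lb_le_inf => // b Sb'.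
  rewrite lerBlDl.
  by have [c Sc] := SD _ _ _ _ Sa Sb'; apply: le_trans; exact: ge_inf.
rewrite le_eqVlt => /predU1P[<-|t0].
  rewrite scale0r mul0r.
  have := leZ 2 0 ltac:(lra); have := leZ (2^-1) 0 ltac:(lra).
  rewrite !scaler0; lra.
apply/le_anti; rewrite leZ//= -ler_pdivlMl//.
have := leZ (t^-1) (t%:C *: x); rewrite invr_gt0 => /(_ t0).
by rewrite scalerA -rmorphM mulVf ?gt_eqF// scale1r.
Qed.

(** Zorn's lemma, with the pointwise order reversed. *)
Lemma minimal_sublinear p : sublinear p ->
  exists q, [/\ sublinear q, forall x, q x <= p x &
    forall q', sublinear q' -> (forall x, q' x <= q x) -> q' = q].
Proof.
move=> sp; pose T := {q | sublinear q /\ forall x, q x <= p x}.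
pose le (q q' : T) := `[< forall x, sval q' x <= sval q x >].
have [|||C totC|[q [sq qp]] qmin] := @Zorn T le.
- by move=> q; apply/asboolP.
- move=> q1 q2 q3 /asboolP q12 /asboolP q23; apply/asboolP => x.
  exact: le_trans (q23 x) (q12 x).
- move=> [q1 Pq1] [q2 Pq2] /asboolP q12 /asboolP q21.
  by apply: eq_exist; apply/funext => x; apply/le_anti; rewrite q12 q21.
- (* a chain is bounded by its pointwise infimum; adding p itself to the
     chain takes care of the empty chain *)
  pose p0 : T := exist _ p (conj sp (fun x => lexx (p x))).
  pose D : set T := [set q | C q \/ q = p0].
  have le_p0 (q : T) : le p0 q by apply/asboolP => x; exact: (svalP q).2.
  have totD : total_on D le.
    move=> q q' [Cq|->] [Cq'|->]; [exact: totC|right|left|left]; exact: le_p0.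
  pose S x : set R := [set a | exists2 q, D q & a = sval q x].
  have Slb x : has_lbound (S x).
    exists (- p (- x)) => _ [q _ ->].
    apply: le_trans (sublinear_ge x (svalP q).1).
    by rewrite lerN2; exact: (svalP q).2.
  have Dp0 : D p0 by right.
  have sS : sublinear (fun x => inf (S x)).
    apply: sublinear_inf => // [x|x y _ _ [q Dq ->] [q' Dq' ->]|].
    + by exists (p x), p0.
    + have [/asboolP qq'|/asboolP qq'] := totD _ _ Dq Dq'.
        exists (sval q' (x + y)); first by exists q'.
        by apply: le_trans ((svalP q').1.1 _ _) _; rewrite lerD2r.
      exists (sval q (x + y)); first by exists q.
      by apply: le_trans ((svalP q).1.1 _ _) _; rewrite lerD2l.
    + move=> t x _ t0 [q Dq ->]; exists q => //.
      by rewrite (svalP q).1.2// ltW.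
  have Sp x : inf (S x) <= p x by apply: ge_inf => //; exists p0.
  exists (exist _ (fun x => inf (S x)) (conj sS Sp)) => q Cq.
  apply/asboolP => x /=.
  by apply: ge_inf => //; exists q => //; left.
- exists q; split=> // q' sq' q'q.
  have q'p x : q' x <= p x := le_trans (q'q x) (qp x).
  by have [] := qmin (exist _ q' (conj sq' q'p)) (asboolT q'q).
Qed.

(** The largest sublinear functional q below p such that q (- y) <= - p y.
    A linear functional below it must take the value p y at y. *)
Definition tilt p y x : R :=
  inf [set a | exists2 t : R, 0 <= t & a = p (x + t%:C *: y) - t * p y].

Section tilt_theory.
Context (p : V -> R) (y : V) (sp : sublinear p).

Let tilt_lbound x :
  has_lbound [set a | exists2 t : R, 0 <= t & a = p (x + t%:C *: y) - t * p y].
Proof.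
exists (- p (- x)) => _ [t t0 ->].
have := sp.1 (- x) (x + t%:C *: y).
rewrite addKr sp.2//; lra.
Qed.

Lemma tilt_le (t : R) x : 0 <= t -> tilt p y x <= p (x + t%:C *: y) - t * p y.
Proof. by move=> t0; apply: ge_inf => //; exists t. Qed.

Lemma tilt_le_id x : tilt p y x <= p x.
Proof.
apply: le_trans (tilt_le _ (lexx _)) _.
by rewrite scale0r mul0r addr0 subr0.
Qed.

Lemma sublinear_tilt : sublinear (tilt p y).
Proof.
apply: sublinear_inf => // [x|x x' _ _ [t t0 ->] [t' t'0 ->]|s x _ s0 [t t0 ->]].
- by exists (p x), 0 => //; rewrite scale0r mul0r addr0 subr0.
- exists (p (x + x' + (t + t')%:C *: y) - (t + t') * p y).
    by exists (t + t') => //; rewrite addr_ge0.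
  have := sp.1 (x + t%:C *: y) (x' + t'%:C *: y).
  rewrite rmorphD scalerDl addrACA; lra.
- exists (s * t); first by rewrite mulr_ge0// ltW.
  by rewrite rmorphM -scalerA -scalerDr sp.2 1?ltW// mulrBr mulrA.
Qed.

Lemma tilt_opp : tilt p y (- y) <= - p y.
Proof.
apply: le_trans (tilt_le _ ler01) _.
by rewrite scale1r addNr mul1r sublinear0// sub0r.
Qed.

End tilt_theory.

(** Minimality forces q = tilt q y for all y, which is additivity. *)
Lemma linear_minorant p : sublinear p ->
  exists q, [/\ forall x y, q (x + y) = q x + q y,
    forall (t : R) x, q (t%:C *: x) = t * q x & forall x, q x <= p x].
Proof.
move=> /minimal_sublinear[q [sq qp qmin]]; exists q.
have tq y : tilt q y = q.
  by apply: qmin; [exact: sublinear_tilt|exact: tilt_le_id].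
have qD x y : q (x + y) = q x + q y.
  apply/le_anti; rewrite sq.1 /=.
  have := @tilt_le q y sq 1 x ler01; rewrite tq scale1r; lra.
have qN x : q (- x) = - q x.
  have := qD x (- x); rewrite subrr sublinear0//; lra.
split=> // t x; have [t0|t0] := leP 0 t; first exact: sq.2.
have := sq.2 (- t) x; rewrite rmorphN scaleNr qN => H.
have := H ltac:(lra); lra.
Qed.

End sublinear.

Section hahn_banach.
Context (R : realType) (V : normedModType R[i]).

Lemma sublinear_rnorm : sublinear (@rnorm R V).
Proof.
split=> [x y|t x t0]; first exact: ler_rnormD.
by rewrite rnormZ rnormR ger0_norm.
Qed.

(** A real functional q is the real part of the complex functional
    x |-> q x - i q (i x), which is linear over R[i] because q is linear
    over R. *)
Lemma dual_minorant (p : V -> R) (M : R) : sublinear p ->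
  (forall x, p x <= M * rnorm x) ->
  exists g : dual V, forall x, complex.Re (g x) <= p x.
Proof.
move=> /linear_minorant[q [qD qZ qp]] pM.
pose g x : R[i]^o := q x +i* - q ('i *: x).
have qN x : q (- x) = - q x.
  by rewrite -scaleN1r -(rmorphN1 (real_complex R)) qZ mulN1r.
have qii x : q ('i *: ('i *: x)) = - q x.
  by rewrite scalerA -expr2 sqr_i scaleN1r qN.
have lg : linear g.
  move=> [a b] x y; rewrite /g qD scalerDr qD.
  have -> : (a +i* b) *: x = a%:C *: x + b%:C *: ('i *: x).
    by rewrite scalerA -scalerDl; congr (_ *: _); simpc.
  rewrite qD !scalerDr !qD !qZ !(scalerA 'i) ![ 'i * _]mulrC -!scalerA !qZ qii.
  rewrite /GRing.scale /= ; simpc.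
  by apply/eqP; rewrite eq_complex /=; apply/andP; split; apply/eqP; lra.
have qM x : `|q x| <= M * rnorm x.
  rewrite ler_norml (le_trans (qp x))// andbT.
  have := le_trans (qp (- x)) (pM (- x)); rewrite qN rnormN; lra.
have gM x : `|g x| <= (2 * M)%:C * `|x|.
  rewrite -(rnormE x) -rmorphM.
  have -> : g x = (q x)%:C - 'i * (q ('i *: x))%:C by rewrite /g; simpc.
  apply: le_trans (ler_normB _ _) _.
  rewrite normrM -!rnormE -!rmorphM -rmorphD lecR.
  rewrite !rnormR rnorm_i mul1r.
  have := qM x; have := qM ('i *: x); rewrite rnormZ rnorm_i mul1r; lra.
by exists (Dual (bounded_dual_pred lg gM)) => x /=; exact: qp.
Qed.

(** Tilting the norm in the direction x yields a functional with real part
    |x| at x. *)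
Lemma dual_separates (x : V) : (forall f : dual V, f x = 0) -> x = 0.
Proof.
move=> fx0; have sn := sublinear_rnorm.
have [|g gp] := @dual_minorant (tilt (@rnorm R V) x) 1 (sublinear_tilt _ sn).
  by move=> y; rewrite mul1r; exact: tilt_le_id.
apply: rnorm_eq0; apply/le_anti; rewrite rnorm_ge0 andbT.
have := le_trans (gp (- x)) (tilt_opp x sn).
by rewrite linearN /= fx0 oppr0 /= lerNr oppr0.
Qed.

End hahn_banach.

Section canonical_embedding.
Context (R : realType) (V : normedModType R[i]).

Lemma bidual_eval_subproof (x : V) :
  (fun f : dual V => f x : R[i]^o) \in @dual_pred R (dual V).
Proof.
apply: (@bounded_dual_pred _ _ _ `|x|) => [k f g //|f].
by rewrite mulrC; exact: ler_dual_norm.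
Qed.

Definition bidual_eval (x : V) : bidual V := Dual (bidual_eval_subproof x).

Lemma bidual_eval_linear : linear bidual_eval.
Proof. by move=> k x y; apply: dual_ext => f /=; rewrite linearP. Qed.

Lemma bidual_eval_eq0 (x : V) : bidual_eval x = 0 -> x = 0.
Proof.
move=> x0; apply: dual_separates => f.
by have : bidual_eval x f = 0 by rewrite x0.
Qed.

End canonical_embedding.

(** * A right identity in the second dual *)

Section right_identity.
Context (R : realType) (A : normedAlgType R[i]).

(** The functional p f = limsup Re f (e_i) is sublinear and is dominated by the
    norm; E is a complex functional with Re E <= p.  Where f (e_i) converges,
    p f and - p (- f) coincide with the limit of the real parts, so that E f
    is the limit.  This applies to the functionals f a, because a e_i tends
    to a. *)
Lemma bidual_right_identity : has_bounded_approximate_identity A ->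
  exists E : bidual A, forall F : bidual A, F ** E = F.
Proof.
move=> [I [le [e [[[i1] le_refl le_trans' le_dir] [M eM] eA]]]].
have {}eM i : rnorm (e i) <= complex.Re M.
  by have := eM i; rewrite -rnormE lecE => /andP[].
(* the infimum of the eventual upper bounds is the upper limit *)
pose S (f : dual A) : set R :=
  [set c | exists i0, forall i, le i0 i -> complex.Re (f (e i)) <= c].
have bound (f : dual A) i : complex.Re (f (e i)) <= complex.Re M * rnorm f.
  apply: le_trans (Re_le_rnorm _) _.
  have : rnorm (f (e i)) <= rnorm f * rnorm (e i).
    by rewrite -lecR rmorphM /= !rnormE; exact: ler_dual_norm.
  move=> /le_trans; apply; rewrite mulrC ler_wpM2r ?rnorm_ge0//.
have Slb f : has_lbound (S f).
  exists (- (complex.Re M * rnorm f)) => c [i0 /(_ i0 (le_refl _))].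
  have := bound (- f) i0; rewrite rnormN.
  have -> : (- f) (e i0) = - f (e i0) by [].
  rewrite raddfN /=; lra.
have sS : sublinear (fun f => inf (S f)).
  apply: sublinear_inf => // [f|f g a b [i0 fa] [j0 gb]|t f a t0 [i0 fa]].
  - by exists (complex.Re M * rnorm f), i1.
  - exists (a + b) => //; have [k [ik jk]] := le_dir i0 j0; exists k => i ki.
    rewrite dualD raddfD /= lerD ?fa ?gb//; exact: le_trans' ki.
  - exists i0 => i ii; rewrite dualZ.
    have -> : complex.Re (t%:C *: f (e i)) = t * complex.Re (f (e i)).
      by case: (f (e i)) => x y /=; rewrite /GRing.scale /= mul0r subr0.
    by rewrite ler_pM2l// fa.
have [|E EP] := @dual_minorant _ _ _ (complex.Re M) sS.
  by move=> f; apply: ge_inf => //; exists i1 => i _; exact: bound.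
have Re_le (f : dual A) a : complex.Re (E (dual_mulr f a)) <= complex.Re (f a).
  apply: le_trans (EP _) _; apply/ler_addgt0Pr => d d0.
  apply: ge_inf => //.
  have aea : a ** e i @[i --> net_filter le] --> a := (eA a).2.
  have FF : Filter (net_filter le).
    split.
    - by exists i1.
    - move=> P Q [i0 Pi] [j0 Qj]; have [k [ik jk]] := le_dir i0 j0.
      exists k => i ki; split; [apply: Pi|apply: Qj]; exact: le_trans' ki.
    - by move=> P Q PQ [i0 Pi]; exists i0 => i /Pi /PQ.
  have : f (a ** e i) @[i --> net_filter le] --> f a.
    by apply: continuous_cvg aea; exact: dual_continuous.
  move=> /cvgr_dist_le/(_ d%:C); rewrite ltcR => /(_ d0)[i0 Pi].
  exists i0 => i /Pi /=; rewrite distrC -rnormE lecR => H.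
  have := le_trans (Re_le_rnorm _) H; rewrite raddfB /=; lra.
(* applied to - f this gives the equality of real parts, and then to i f that
   of imaginary parts *)
have Re_eq (f : dual A) a : complex.Re (E (dual_mulr f a)) = complex.Re (f a).
  apply/le_anti; rewrite Re_le /=.
  have := Re_le (- f) a.
  have -> : dual_mulr (- f) a = - dual_mulr f a by apply: dual_ext.
  by rewrite linearN /= !raddfN /= lerN2.
exists E => F; apply: dual_ext => f /=.
congr (F _); apply: dual_ext => a /=.
apply/eqP; rewrite eq_complex Re_eq eqxx /=; apply/eqP.
have := Re_eq ('i *: f) a.
have -> : dual_mulr ('i *: f) a = 'i *: dual_mulr f a by apply: dual_ext.
rewrite linearZ /= => Hi; apply: oppr_inj.
have Re_i (z : R[i]) : complex.Re ('i * z) = - complex.Im z.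
  by rewrite mulrC ReiNIm.
by rewrite -[LHS]Re_i -[RHS]Re_i; exact: Hi.
Qed.

End right_identity.

(** * Multiplication *)

Section amul_theory.
Context (K : numFieldType) (B : normedAlgType K).
Implicit Types a b c : B.

Lemma amul0 a : a ** 0 = 0.
Proof. by rewrite -(scale0r (0 : B)) amulZr !scale0r. Qed.

Lemma amul0r a : 0 ** a = 0.
Proof. by rewrite -(scale0r (0 : B)) amulZl !scale0r. Qed.

Lemma amulNl a b : - a ** b = - (a ** b).
Proof. by rewrite -scaleN1r amulZl scaleN1r. Qed.

Lemma amulNr a b : a ** - b = - (a ** b).
Proof. by rewrite -scaleN1r amulZr scaleN1r. Qed.

Lemma amulBl a b c : (a - b) ** c = a ** c - b ** c.
Proof. by rewrite amulDl amulNl. Qed.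

Lemma amulBr a b c : a ** (b - c) = a ** b - a ** c.
Proof. by rewrite amulDr amulNr. Qed.

Lemma amul_suml (I : finType) (P : pred I) (F : I -> B) a :
  (\sum_(i | P i) F i) ** a = \sum_(i | P i) F i ** a.
Proof.
elim/big_rec2: _ => [|i x y _ <-]; first by rewrite amul0r.
by rewrite amulDl.
Qed.

Lemma amul_sumr (I : finType) (P : pred I) (F : I -> B) a :
  a ** (\sum_(i | P i) F i) = \sum_(i | P i) a ** F i.
Proof.
elim/big_rec2: _ => [|i x y _ <-]; first by rewrite amul0.
by rewrite amulDr.
Qed.

End amul_theory.

(** * Normed division algebras *)

Section resolvent.
Context (R : realType) (B : normedAlgType R[i]).

Lemma root_exp2n (m : nat) (d : R[i]) : exists c, c ^+ (2 ^ m) = d.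
Proof.
elim: m d => [|m IH] d; first by exists d; rewrite expr1.
by have [c cE] := IH (sqrtc d); exists c; rewrite expnSr exprM cE sqr_sqrtc.
Qed.

(** Formally g c = y (1 - c y)^-1, and the element s produced for m is
    y (1 - c^n y^n)^-1 with n = 2^m, the average of g over the n-th roots of
    c^n.  One of these n values is g c and the others have norm at most M,
    whence the bound.  The averages are formed by halving, from
    1/(1 - z) + 1/(1 + z) = 2/(1 - z^2). *)
Lemma root_average (y : B) (g : R[i] -> B) (M : R) :
  (forall c, g c = y + c *: (y ** g c)) -> (forall c, rnorm (g c) <= M) ->
  forall (m : nat) c, exists2 s,
    s = y + c ^+ (2 ^ m) *: (iter m (fun z => z ** z) y ** s) &
    2 ^+ m * rnorm s <= (2 ^+ m - 1) * M + rnorm (g c).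
Proof.
move=> gE gM; elim=> [|m IH] c.
  exists (g c); first by rewrite expr1 -gE.
  by rewrite expr0 subrr mul0r mul1r add0r.
have [c' c'E] := root_exp2n m (- c ^+ (2 ^ m)).
have [s sE sM] := IH c; have [s' s'E s'M] := IH c'.
exists (2^-1 *: (s + s')); last first.
  have := ler_rnormD s s'; rewrite rnormZ => ss'.
  have -> : rnorm (2^-1 : R[i]) = 2^-1.
    rewrite -[RHS]ger0_norm; last by lra.
    by rewrite -rnormR fmorphV rmorph_nat.
  have h0 : 0 <= (2 ^+ m : R) by rewrite exprn_ge0.
  have := ler_wpM2l h0 ss'.
  have := gM c'; rewrite exprS; lra.
move: sE s'E; rewrite c'E; set k := c ^+ _; set w := iter m _ y => sE s'E.
have wE : iter m.+1 (fun z => z ** z) y = w ** w by [].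
rewrite wE expnSr exprM -/k.
have D : s - s' = k *: (w ** (s + s')).
  by rewrite {1}sE {1}s'E scaleNr opprD opprK addrACA subrr add0r amulDr scalerDr.
have S2 : s + s' = y + y + (k ^+ 2) *: (w ** w ** (s + s')).
  rewrite {1}sE {1}s'E addrACA scaleNr -scalerBr -amulBr D.
  by rewrite amulZr scalerA amulA -expr2.
have half (z : B) : 2^-1 *: (z + z) = z.
  have h1 : 2^-1 + 2^-1 = 1 :> R[i] by rewrite [RHS]splitr mul1r.
  by rewrite scalerDr -scalerDl h1 scale1r.
rewrite amulZr {1}S2 scalerDr half.
by rewrite !scalerA [k ^+ 2 * _]mulrC.
Qed.

Context (r : R[i] -> B)
  (resolventE : forall l m, r l - r m = (l - m) *: (r l ** r m)).

(** Where the norm of the resolvent is maximal it is locally constant: the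
    average over the n-th roots of c^n tends to r l as n grows, and the error
    c^n r(l)^n beats the weight 1/n of the value at l + c. *)
Lemma resolvent_max_spreads (l c : R[i]) :
  (forall m, rnorm (r m) <= rnorm (r l)) -> rnorm c * rnorm (r l) <= 4^-1 ->
  rnorm (r (l + c)) = rnorm (r l).
Proof.
move=> rM c4; apply/le_anti; rewrite rM /=.
set M := rnorm (r l) in rM c4 *; set y := r l in M rM c4 *.
pose g d := r (l + d).
have gE d : g d = y + d *: (y ** g d).
  have := resolventE l (l + d); rewrite -/y -/(g d) opprD addNKr scaleNr.
  by move=> /(congr1 -%R); rewrite opprB opprK => <-; rewrite addrC subrK.
have gM0 d : rnorm (g d) <= M by exact: rM.
have small m : rnorm (c ^+ (2 ^ m) *: iter m (fun z => z ** z) y) <= 4^-1 ^+ m.+1.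
  elim: m => [|m IH]; first by rewrite expr1 rnormZ expr1.
  have -> : c ^+ (2 ^ m.+1) *: iter m.+1 (fun z => z ** z) y =
      (c ^+ (2 ^ m) *: iter m (fun z => z ** z) y) **
      (c ^+ (2 ^ m) *: iter m (fun z => z ** z) y).
    by rewrite amulZl amulZr scalerA -expr2 -exprM -expnSr.
  apply: le_trans (rnorm_amul _ _) _.
  apply: le_trans (ler_pM (rnorm_ge0 _) (rnorm_ge0 _) IH IH) _.
  rewrite -exprD; apply: ler_wiXn2l; [lra|lra|by rewrite addSn ltnS leq_addl].
(* the error is at most M / 4^(m+1), so that multiplying the estimate by 2^m
   once more still leaves a bounded right-hand side *)
have key m : 2 ^+ m * (M - rnorm (g c)) <= M.
  have [s sE sM] := root_average gE (fun d => rM (l + d)) m c.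
  have ys : y = s - (c ^+ (2 ^ m) *: iter m (fun z => z ** z) y) ** s.
    by rewrite amulZl {1}sE addrK.
  have Ms : M <= rnorm s + 4^-1 ^+ m.+1 * rnorm s.
    rewrite /M {1}ys; apply: le_trans (ler_rnormD _ _) _; rewrite lerD2l rnormN.
    apply: le_trans (rnorm_amul _ _) _; rewrite ler_wpM2r ?rnorm_ge0//.
  have := gM0 c.
  have ab : 2 ^+ m * 2 ^+ m * 4^-1 ^+ m.+1 = 4^-1 :> R.
    rewrite -exprMn exprS mulrCA -exprMn.
    by rewrite (_ : 2 * 2 * 4^-1 = 1 :> R) ?expr1n ?mulr1//; lra.
  have a1 : 1 <= 2 ^+ m :> R by rewrite exprn_ege1//; lra.
  have b0 : 0 <= 4^-1 ^+ m.+1 :> R by rewrite exprn_ge0//; lra.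
  move: (2 ^+ m) (4^-1 ^+ m.+1) ab a1 b0 sM Ms => a b ab a1 b0 sM Ms gcM.
  have sM' : rnorm s <= M by nra.
  have bs : b * rnorm s <= b * M by rewrite ler_wpM2l.
  have aMs : a * M <= a * (rnorm s + b * M) by rewrite ler_wpM2l//; lra.
  have M0 : 0 <= M := rnorm_ge0 _.
  have Mg : M - rnorm (g c) <= a * b * M by lra.
  have : a * (M - rnorm (g c)) <= a * (a * b * M) by rewrite ler_wpM2l//; lra.
  rewrite !mulrA ab; lra.
rewrite leNgt; apply/negP => gM1; have d0 : 0 < M - rnorm (g c) by rewrite subr_gt0.
pose m := Num.bound (M / (M - rnorm (g c))).
have := key m; apply/negP; rewrite -ltNge -ltr_pdivrMr//.
apply: lt_le_trans (archi_boundP _) _.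
  by rewrite divr_ge0 ?rnorm_ge0// ltW.
by rewrite -natrX ler_nat ltnW// ltn_expl.
Qed.

End resolvent.

Section gelfand_mazur.
Context (R : realType) (B : normedAlgType R[i]).

(** The resolvent of an element with empty spectrum: the reciprocal of its
    norm is 1-Lipschitz and tends to infinity, hence attains its minimum; the
    maximum of the norm then spreads along an entire ray, which contradicts
    the behaviour at infinity. *)
Lemma no_entire_resolvent (x e : B) (r : R[i] -> B) : e <> 0 ->
  (forall l m, r l - r m = (l - m) *: (r l ** r m)) ->
  (forall l, x ** r l = e + l *: r l) -> False.
Proof.
move=> e0 resolventE xrE.
have r0 l : 0 < rnorm (r l).
  apply: rnorm_gt0 => rl0; apply: e0.
  by have := xrE l; rewrite rl0 amul0 scaler0 addr0 => <-.
pose h l := (rnorm (r l))^-1.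
have lip l m : h l <= h m + rnorm (l - m).
  have : rnorm (r m) <= rnorm (r l) + rnorm (l - m) * (rnorm (r l) * rnorm (r m)).
    have -> : r m = r l - (r l - r m) by rewrite subKr.
    apply: le_trans (ler_rnormD _ _) _; rewrite lerD2l rnormN subKr.
    rewrite resolventE rnormZ ler_wpM2l ?rnorm_ge0//; exact: rnorm_amul.
  have := r0 l; have := r0 m; rewrite /h.
  move: (rnorm (r l)) (rnorm (r m)) (rnorm (l - m)) => a b d b0 a0 H.
  have ab0 : 0 <= a^-1 * b^-1 by rewrite mulr_ge0 ?invr_ge0 ?ltW.
  have := ler_wpM2l ab0 H; rewrite mulrDr.
  rewrite -[a^-1 * b^-1 * b]mulrA mulVf ?gt_eqF// mulr1.
  rewrite [a^-1 * b^-1 * a]mulrAC mulVf ?gt_eqF// mul1r.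
  by rewrite mulrCA mulrACA !mulVf ?gt_eqF// !mulr1.
have growth l : rnorm l - rnorm x <= rnorm e * h l.
  rewrite ler_pdivlMr// mulrBl lerBlDl -rnormZ.
  have -> : l *: r l = x ** r l - e by rewrite xrE addrAC subrr add0r.
  apply: le_trans (ler_rnormD _ _) _; rewrite rnormN lerD2r; exact: rnorm_amul.
(* outside the square of half-side rho, h is at least h 0 by growth *)
pose rho := rnorm x + rnorm e * h 0.
have rho0 : 0 <= rho by rewrite addr_ge0 ?mulr_ge0 ?invr_ge0 ?rnorm_ge0.
pose K : set (R * R) := `[- rho, rho] `*` `[- rho, rho].
have [||F|p0 _ p0min] := @compact_EVT_min _ _ (fun p : R * R => h (p.1 +i* p.2)) K.
- by exists (0, 0); split => /=; rewrite in_itv /=; apply/andP; split; lra.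
- by apply: compact_setX; exact: segment_compact.
- apply: continuous_subspaceT => p; apply/cvgrPdist_le => d d0.
  have d2 : 0 < d / 2 by lra.
  have near1 : \forall q \near p, `|p.1 - q.1| <= d / 2.
    have /cvgrPdist_le : q.1 @[q --> p] --> p.1 by exact: cvg_fst.
    exact.
  have near2 : \forall q \near p, `|p.2 - q.2| <= d / 2.
    have /cvgrPdist_le : q.2 @[q --> p] --> p.2 by exact: cvg_snd.
    exact.
  near=> q.
  have q1 : `|p.1 - q.1| <= d / 2 by near: q.
  have q2 : `|p.2 - q.2| <= d / 2 by near: q.
  have := rnorm_le_ReIm (p.1 +i* p.2 - q.1 +i* q.2).
  have := lip (p.1 +i* p.2) (q.1 +i* q.2).
  have := lip (q.1 +i* q.2) (p.1 +i* p.2).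
  rewrite -[rnorm (q.1 +i* q.2 - _)]rnormN opprB /= ler_norml => *.
  apply/andP; split; lra.
pose l0 := p0.1 +i* p0.2.
have l0min l : h l0 <= h l.
  have [lK|lK] := pselect (K (complex.Re l, complex.Im l)).
    by case: l lK => a b /= lK; exact: (p0min _ (mem_set lK)).
  have h00 : h l0 <= h 0.
    apply: (p0min (0, 0)); apply: mem_set.
    by split => /=; rewrite in_itv /=; apply/andP; split; lra.
  apply: le_trans h00 _; have := growth l.
  have rl : rho <= rnorm l.
    have Rel := normRe_le_rnorm l; have Iml := normIm_le_rnorm l.
    rewrite leNgt; apply/negP => lrho; apply: lK.
    by split=> /=; rewrite in_itv /= -ler_norml;
      [apply: le_trans Rel _|apply: le_trans Iml _]; exact: ltW.
  move=> gr; rewrite -(@ler_pM2l _ (rnorm e)) ?rnorm_gt0//.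
  apply: le_trans gr; rewrite /rho in rl; lra.
have rM l : rnorm (r l) <= rnorm (r l0).
  by have := l0min l; rewrite /h lef_pV2 // ?posrE.
set M := rnorm (r l0) in rM.
have M0 : 0 < M := r0 l0.
(* the largest step that resolvent_max_spreads allows *)
pose c : R[i] := ((4 * M)^-1)%:C.
have cM : rnorm c = (4 * M)^-1.
  by rewrite rnormR ger0_norm// invr_ge0; lra.
have ray k : rnorm (r (l0 + c *+ k)) = M.
  elim: k => [|k IH]; first by rewrite mulr0n addr0.
  rewrite mulrSr addrA -IH; apply: resolvent_max_spreads => //.
    by move=> m; rewrite IH.
  by rewrite IH cM invfM -mulrA mulVf ?gt_eqF// mulr1.
(* beyond C steps of length 1 / (4 M), growth fails *)
pose C := 4 * M * (rnorm x + rnorm e * M^-1 + rnorm l0).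
have C0 : 0 <= C.
  by rewrite mulr_ge0 ?addr_ge0 ?mulr_ge0 ?invr_ge0 ?rnorm_ge0 ?ltW.
pose k := Num.bound C.
have kC : C < k%:R := archi_boundP C0.
have := growth (l0 + c *+ k); rewrite /h ray.
have : rnorm (c *+ k) <= rnorm (l0 + c *+ k) + rnorm l0.
  by rewrite -{1}(addKr l0 (c *+ k)) addrC;
    apply: le_trans (ler_rnormD _ _) _; rewrite rnormN.
have -> : rnorm (c *+ k) = k%:R * (4 * M)^-1.
  rewrite /c -[_ *+ k]mulr_natl -(rmorph_nat (real_complex R)) -rmorphM rnormR ger0_norm//.
  by rewrite mulr_ge0 ?ler0n// invr_ge0 mulr_ge0// ltW.
move: kC; rewrite /C -ltr_pdivlMl ?mulr_gt0// [k%:R * _]mulrC; lra.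
Unshelve. all: by end_near. Qed.

End gelfand_mazur.

(** * Minimal left ideals and the socle *)

Section minimal_left_ideals.
Context (R : realType) (B : normedAlgType R[i]).
Implicit Types (x y u v e : B) (L : set B).

Lemma minimal_left_ideal_left L : minimal_left_ideal L -> left_ideal L.
Proof. by case. Qed.

(** Schur's lemma: L is generated by any u that some element does not kill. *)
Lemma minimal_left_ideal_cyclic L a u v : minimal_left_ideal L ->
  L u -> a ** u <> 0 -> L v -> exists b, v = b ** u.
Proof.
move=> [[L0 LD LZ LM] _ Lmin] Lu au Lv.
have [||Bu|BuL] := Lmin [set x | exists b, x = b ** u].
- split=> [|_ _ [b ->] [b' ->]|k _ [b ->]|c _ [b ->]].
  + by exists 0; rewrite amul0r.
  + by exists (b + b'); rewrite amulDl.
  + by exists (k *: b); rewrite amulZl.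
  + by exists (c ** b); rewrite amulA.
- by move=> _ [b ->]; exact: LM.
- suff : [set 0] (a ** u) by [].
  by rewrite -Bu; exists a.
- by have : L v := Lv; rewrite -BuL.
Qed.

(** The corner e B e is a normed division algebra; if x were not a multiple
    of its unit e, all the x - l e would be invertible in it. *)
Lemma minimal_corner_scalar L e x : minimal_left_ideal L -> L e ->
  e ** e = e -> e ** x = x -> x ** e = x -> exists l, x = l *: e.
Proof.
move=> Lmin Le ee ex xe; have [[L0 LD LZ LM] _ _] := Lmin.
(* every nonzero element of e B e has a left inverse there, so every left
   inverse is two-sided *)
have corner_inv z : e ** z = z -> z ** e = z -> z <> 0 ->
    exists w, [/\ w ** z = e, z ** w = e, e ** w = w & w ** e = w].
  have left_inv y : e ** y = y -> y ** e = y -> y <> 0 ->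
      exists w, [/\ w ** y = e, e ** w = w & w ** e = w].
    move=> ey ye y0; have Ly : L y by rewrite -ye; exact: LM.
    have [|b eb] := @minimal_left_ideal_cyclic L e y e Lmin Ly _ Le.
      by rewrite ey.
    exists (e ** b ** e); split.
    - by rewrite -amulA ey -amulA -eb.
    - by rewrite !amulA ee.
    - by rewrite -amulA ee.
  move=> ez ze z0; have [w [wz ew we]] := left_inv z ez ze z0.
  have [|w' [w'w ew' w'e]] := left_inv w ew we.
    by move=> w0; apply: z0; rewrite -ez -wz w0 !amul0r.
  exists w; split=> //.
  by rewrite -ez -{1}w'w -!amulA (amulA w z w) wz ew.
apply: contrapT => xNl.
have e0 : e <> 0 by move=> e0; apply: xNl; exists 0; rewrite scale0r -xe e0 amul0.
have /choice[r rP] l : exists w, [/\ w ** (x - l *: e) = e,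
    (x - l *: e) ** w = e, e ** w = w & w ** e = w].
  apply: corner_inv.
  - by rewrite amulBr amulZr ee ex.
  - by rewrite amulBl amulZl ee xe.
  - by move=> /eqP; rewrite subr_eq0 => /eqP xl; apply: xNl; exists l.
apply: (@no_entire_resolvent R B x e r e0) => [l m|l].
- have [rl _ _ rle] := rP l; have [_ rm erm _] := rP m.
  have -> : r l - r m = r l ** ((x - m *: e) - (x - l *: e)) ** r m.
    by rewrite amulBr amulBl rl erm -amulA rm rle.
  rewrite [_ - (x - l *: e)]addrC opprB addrA subrK -scalerBl.
  by rewrite amulZr rle amulZl.
- have [_ rl er _] := rP l.
  by rewrite -rl amulBl amulZl er subrK.
Qed.

(** Schur gives v = b u, so v = (f b f) u, and f b f is a multiple of f. *)
Lemma minimal_corner_rank1 L e f u v : minimal_left_ideal L ->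
  L u -> L v -> (exists2 L', minimal_left_ideal L' & L' f) -> f ** f = f ->
  f ** u = u -> f ** v = v -> u <> 0 -> exists l, v = l *: u.
Proof.
move=> Lmin Lu Lv [L' L'min L'f] ff fu fv u0.
have [|b vb] := @minimal_left_ideal_cyclic L f u v Lmin Lu _ Lv.
  by rewrite fu.
have [||l fbf] := @minimal_corner_scalar L' f (f ** b ** f) L'min L'f ff.
- by rewrite !amulA ff.
- by rewrite -amulA ff.
by exists l; rewrite -[in RHS]fu -amulZl -fbf -amulA fu -amulA -vb fv.
Qed.

Definition sum_mem (I : finType) (L : I -> set B) (S : {set I}) (x : B) :=
  exists2 l : I -> B, forall i, i \in S -> L i (l i) & x = \sum_(i in S) l i.

Lemma left_ideal_sum_mem (I : finType) (L : I -> set B) (S : {set I}) :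
  (forall i, left_ideal (L i)) -> left_ideal (sum_mem L S).
Proof.
move=> Lid; split.
- exists (fun=> 0) => [i _|]; first by have [] := Lid i.
  by rewrite big1.
- move=> _ _ [l lL ->] [l' l'L ->]; exists (fun i => l i + l' i).
    by move=> i iS; have [_ + _ _] := Lid i; apply; [exact: lL|exact: l'L].
  by rewrite big_split.
- move=> k _ [l lL ->]; exists (fun i => k *: l i).
    by move=> i iS; have [_ _ + _] := Lid i; apply; exact: lL.
  by rewrite scaler_sumr.
- move=> a _ [l lL ->]; exists (fun i => a ** l i).
    by move=> i iS; have [_ _ _] := Lid i; apply; exact: lL.
  by rewrite amul_sumr.
Qed.

Lemma socle_sum_mem x : socle B x -> exists (I : finType) (L : I -> set B),
  (forall i, minimal_left_ideal (L i)) /\ sum_mem L [set: I] x.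
Proof.
pose Sum : set B := [set y | exists (I : finType) (L : I -> set B),
  (forall i, minimal_left_ideal (L i)) /\ sum_mem L [set: I] y].
suff SumP : left_ideal Sum /\ (\bigcup_(L in minimal_left_ideal (B := B)) L) `<=` Sum.
  by move=> /(_ Sum SumP).
split.
- split.
  + exists void, (fun=> set0); split; first by case.
    by exists (fun=> 0) => [[]|]; rewrite big1.
  + move=> _ _ [I [L [Lmin [l lL ->]]]] [J [M [Mmin [m mM ->]]]].
    exists (I + J)%type, (fun k => match k with inl i => L i | inr j => M j end).
    split; first by case.
    exists (fun k => match k with inl i => l i | inr j => m j end).
      by case=> k _; [apply: lL|apply: mM]; rewrite inE.
    under [RHS]eq_bigl do rewrite inE; rewrite big_sumType /=.
    by congr (_ + _); apply: eq_bigl => i; rewrite inE.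
  + move=> k a [I [L [Lmin aL]]]; exists I, L; split=> //.
    have [] := left_ideal_sum_mem [set: I]
      (fun i => minimal_left_ideal_left (Lmin i)).
    by move=> _ _ + _; apply.
  + move=> b a [I [L [Lmin aL]]]; exists I, L; split=> //.
    have [] := left_ideal_sum_mem [set: I]
      (fun i => minimal_left_ideal_left (Lmin i)).
    by move=> _ _ _; apply.
- move=> y [L Lmin Ly]; exists unit, (fun=> L); split=> //.
  exists (fun=> y) => //; rewrite (big_pred1 tt)// => i.
  by rewrite inE; case: i.
Qed.

(** When E = sum_i e_i with e_i in a minimal left ideal L i, and no smaller
    subfamily of the L i has E in its sum, this sum is direct: otherwise some L j would lie in the sum
    of the others, and its term could be absorbed there.  Comparing
    e_j = e_j E = sum_i e_j e_i with the trivial decomposition of e_j gives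
    e_j e_j = e_j. *)
Lemma idempotent_decomposition E : (forall x, x ** E = x) -> socle B E ->
  exists (I : finType) (S : {set I}) (e : I -> B),
    E = \sum_(i in S) e i /\ forall i, i \in S ->
      [/\ e i ** e i = e i, e i <> 0 &
          exists2 L, minimal_left_ideal L & L (e i)].
Proof.
move=> xE /socle_sum_mem[I [L [Lmin EL]]].
have Lid i : left_ideal (L i) by have [] := Lmin i.
pose P (S : {set I}) := `[< sum_mem L S E >].
have [S /minsetP[/asboolP[e eL EE] Smin] _] :=
  minset_exists (asboolT EL : P [set: I]%SET).
have NP j : j \in S -> ~ sum_mem L (S :\ j) E.
  move=> jS /asboolT /Smin/(_ (subsetDl _ _))/setP/(_ j).
  by rewrite setD11 jS.
have indep j x : j \in S -> L j x -> sum_mem L (S :\ j) x -> x = 0.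
  move=> jS Lx Sx; apply: contrapT => x0; apply: (NP j jS).
  have SI := left_ideal_sum_mem (S :\ j) Lid.
  have [_ _ Ljmin] := Lmin j.
  have [||J0|JL] := Ljmin (L j `&` sum_mem L (S :\ j)).
  - have [a0 aD aZ aM] := Lid j; have [b0 bD bZ bM] := SI.
    split=> // [a b [? ?] [? ?]|k a [? ?]|a b [? ?]]; split; auto.
  - exact: subIsetl.
  - by case: x0; have : (L j `&` sum_mem L (S :\ j)) x by []; rewrite J0.
  - have [_ bD _ _] := SI; rewrite EE (big_setD1 j)//=; apply: bD.
      by have : L j (e j) := eL _ jS; rewrite -JL => -[].
    exists e => // i /setD1P[_]; exact: eL.
exists I, S, e; split=> // j jS; split; last by exists (L j) => //; exact: eL.
- apply/esym/subr0_eq; apply: (indep j) => //.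
    have [_ aD aZ aM] := Lid j; rewrite -scaleN1r.
    by apply: aD; [exact: eL|apply: aZ; apply: aM; exact: eL].
  have -> : e j - e j ** e j = \sum_(i in S :\ j) e j ** e i.
    rewrite -{1}[e j]xE {1}EE amul_sumr (big_setD1 j)//=.
    by rewrite addrAC subrr add0r.
  exists (fun i => e j ** e i) => // i /setD1P[_ iS].
  by have [_ _ _] := Lid i; apply; exact: eL.
- move=> ej0; apply: (NP j jS); exists e => [i /setD1P[_]|]; first exact: eL.
  by rewrite {1}EE (big_setD1 j)//= ej0 add0r.
Qed.

(** The maps x |-> e_j x e_i have rank at most one, as e_j B e_i consists of
    the homomorphisms between two simple modules.  A common zero x satisfies
    E x e_i = 0; but the elements of L_i killed by E on the left form a left
    ideal that does not contain e_i = e_i E e_i, hence the zero ideal. *)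
Lemma socle_rank1_maps E : (forall x, x ** E = x) -> socle B E ->
  exists (I : finType) (S : {set I}) (e : I -> B),
    (forall i j x y, i \in S -> j \in S -> e j ** y ** e i <> 0 ->
      exists l : R[i], e j ** x ** e i = l *: (e j ** y ** e i)) /\
    (forall x, (forall i j, i \in S -> j \in S -> e j ** x ** e i = 0) -> x = 0).
Proof.
move=> xE /(idempotent_decomposition xE)[I [S [e [EE eP]]]].
exists I, S, e; split=> [i j x y iS jS|x exe].
  have [ei _ [L Lmin Le]] := eP i iS; have [ej _ L'] := eP j jS.
  have [_ _ _ LM] : left_ideal L by have [] := Lmin.
  apply: (@minimal_corner_rank1 L (e i) (e j)) => //; try exact: LM.
  - by rewrite !amulA ej.
  - by rewrite !amulA ej.
suff xe i : i \in S -> x ** e i = 0.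
  by rewrite -[x]xE EE amul_sumr big1.
move=> iS; have [ei ei0 [L [[L0 LD LZ LM] _ Lmin] Le]] := eP i iS.
have [||K0|KL] := Lmin [set y | L y /\ E ** y = 0].
- split=> [|a b [La Ea] [Lb Eb]|k a [La Ea]|a b [Lb Eb]].
  + by split=> //; rewrite amul0.
  + by split; [exact: LD|rewrite amulDr Ea Eb addr0].
  + by split; [exact: LZ|rewrite amulZr Ea scaler0].
  + by split; [exact: LM|rewrite -[a]xE -amulA Eb !amul0].
- by move=> y [].
- suff : [set 0] (x ** e i) by [].
  rewrite -K0; split; first exact: LM.
  by rewrite EE amul_suml big1// => j jS; rewrite amulA exe.
- have [_ Ee] : [set y | L y /\ E ** y = 0] (e i) by rewrite KL.
  by case: ei0; rewrite -ei -{1}[e i]xE -amulA Ee amul0.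
Qed.

End minimal_left_ideals.

(** * Finite dimension *)

(** One basis vector is split off for each map that does not vanish on what
    is left. *)
Lemma finite_dimensional_rank1 (K : numFieldType) (V W : lmodType K)
    (J : eqType) (s : seq J) (T : J -> V -> W) :
  (forall k, linear (T k)) ->
  (forall k x y, k \in s -> T k y <> 0 -> exists c : K, T k x = c *: T k y) ->
  (forall x, (forall k, k \in s -> T k x = 0) -> x = 0) ->
  finite_dimensional V.
Proof.
move=> Tlin Trank Tker.
suff span (D : set V) : (forall (c : K) x y, D x -> D y -> D (c *: x + y)) ->
    (forall x, D x -> (forall k, k \in s -> T k x = 0) -> x = 0) ->
    exists n (v : 'I_n -> V), forall x, D x ->
      exists c : 'I_n -> K, x = \sum_(i < n) c i *: v i.
  have [//|x _|n [v vP]] := span setT; first exact: Tker.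
  by exists n, v => x; exact: vP.
elim: s Trank {Tker} D => [|k s IH] Trank D Dlin Dker.
  exists 0, (fun=> 0) => x Dx; exists (fun=> 0).
  by rewrite big_ord0; apply: Dker.
have [[w Dw Tw]|T0] := pselect (exists2 w, D w & T k w <> 0); last first.
  apply: IH => // [k' x y k's|x Dx Tx].
    by apply: Trank; rewrite inE k's orbT.
  apply: Dker => // k'; rewrite inE => /predU1P[->|]; last exact: Tx.
  by apply: contrapT => Tkx; apply: T0; exists x.
have [|||n [v vP]] := IH _ (D `&` [set x | T k x = 0]).
- by move=> k' x y k's; apply: Trank; rewrite inE k's orbT.
- move=> c x y [Dx Tx] [Dy Ty]; split; first exact: Dlin.
  by rewrite /= Tlin Tx Ty scaler0 addr0.
- move=> x [Dx Tx] Tsx; apply: Dker => // k'.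
  by rewrite inE => /predU1P[->|]; [exact: Tx|exact: Tsx].
(* the maps of s separate the kernel of T k, and x - c0 w lies in it *)
exists n.+1, (fun i => oapp v w (unlift ord0 i)) => x Dx.
have [c0 Tx] := Trank k x w (mem_head _ _) Tw.
have [|c cE] := vP (- c0 *: w + x).
  by split; [exact: Dlin|rewrite /= Tlin Tx scaleNr addNr].
exists (fun i => oapp c c0 (unlift ord0 i)).
rewrite big_ord_recl unlift_none /=.
under eq_bigr do rewrite liftK /=.
by rewrite -cE scaleNr addNKr.
Qed.

Theorem theorem1 (R : realType) (A : banachAlgType R[i]) :
  has_bounded_approximate_identity A ->
  socle (bidual A) = [set: bidual A] ->
  finite_dimensional A.
Proof.
move=> /bidual_right_identity[E FE] socT.
have socE : socle (bidual A) E by rewrite socT.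
have [I [S [e [e_rank1 e_ker]]]] := socle_rank1_maps FE socE.
pose s := [seq p <- enum {: I * I} | (p.1 \in S) && (p.2 \in S)].
have sP p : (p \in s) = (p.1 \in S) && (p.2 \in S).
  by rewrite mem_filter mem_enum andbT.
apply: (@finite_dimensional_rank1 _ _ (bidual A) _ s
  (fun p x => e p.2 ** bidual_eval x ** e p.1)) => [[i j] c x y|[i j] x y|x ex] /=.
- by rewrite bidual_eval_linear amulDr amulZr amulDl amulZl.
- by rewrite sP /= => /andP[iS jS]; exact: e_rank1.
- apply: bidual_eval_eq0; apply: e_ker => i j iS jS.
  by apply: (ex (i, j)); rewrite sP /= iS.
Qed.
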